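(* Let $(w_{n,k})_{n,k\ge0}$ be an array of complex numbers such that, for some constants $L,M$: (i) $w_{n,k}=0$ for $k>n$; (ii) $\lim_{n\to\infty} w_{n,k}=1$ for every $k\ge0$; (iii) $|w_{n,k}|\le M$ for all $n,k\ge0$; (iv) $|w_{n,k}-w_{n,k+1}|\le L/n$ for all $n,k\ge0$ (with $n\ge1$). Given $f\in\mathrm{Hol}(\mathbb D)$, $f(z)=\sum_{k=0}^\infty a_kz^k$, set $p_n(z):=\sum_{k=0}^n w_{n,k}a_kz^k$. Then for every positive finite Borel measure $\mu$ on $\overline{\mathbb D}$ such that $f\in\mathcal D_\mu$, we have $\|f-p_n\|_{\mathcal D_\mu}\to0$ as $n\to\infty$.
   Context: $\mathbb D$ is the open unit disk, $\mathrm{Hol}(\mathbb D)$ the holomorphic functions on $\mathbb D$, and $H^2$ the Hardy space with $\|\sum b_kz^k\|_{H^2}^2=\sum|b_k|^2$. For $\zeta\in\overline{\mathbb D}$, $\mathcal D_\zeta$ is the set of $f\in\mathrm{Hol}(\mathbb D)$ of the form $f(z)=a+(z-\zeta)g(z)$ with $g\in H^2$, $a\in\mathbb C$; for such $f$ set $\mathcal D_\zeta(f):=\|g\|_{H^2}^2$, and set $\mathcal D_\zeta(f):=\infty$ if $f\notin\mathcal D_\zeta$. For a positive finite Borel measure $\mu$ on $\overline{\mathbb D}$, $\mathcal D_\mu(f):=\int_{\overline{\mathbb D}}\mathcal D_\zeta(f)\,d\mu(\zeta)$, $\mathcal D_\mu$ is the set of $f\in\mathrm{Hol}(\mathbb D)$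 with $\mathcal D_\mu(f)<\infty$, normed by $\|f\|_{\mathcal D_\mu}^2:=|f(0)|^2+\mathcal D_\mu(f)$. *)

(* Defs.v *)
From HB Require Import structures.
From mathcomp Require Import all_boot all_order all_algebra.
From mathcomp Require Import all_classical all_reals all_analysis.
From mathcomp Require Import complex.
Import Order.TTheory GRing.Theory Num.Theory numFieldNormedType.Exports.

Set Implicit Arguments.
Unset Strict Implicit.
Unset Printing Implicit Defensive.

Local Open Scope ring_scope.
Local Open Scope classical_set_scope.

Section Dirichlet.
Variable R : realType.

Definition sqmod (z : R[i]) : R := (complex.Re z) ^+ 2 + (complex.Im z) ^+ 2.

Definition cmod (z : R[i]) : R := Num.sqrt (sqmod z).

Definition psum (a : nat -> R[i]) (z : R[i]) (n : nat) : R[i] :=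
  \sum_(k < n) a k * z ^+ k.

Definition pconv (a : nat -> R[i]) (z : R[i]) : Prop :=
  cvgn (fun n => complex.Re (psum a z n)) /\ cvgn (fun n => complex.Im (psum a z n)).

(* its sum (meaningful when pconv a z) *)
Definition pval (a : nat -> R[i]) (z : R[i]) : R[i] :=
  Complex (limn (fun n => complex.Re (psum a z n))) (limn (fun n => complex.Im (psum a z n))).

(* Hol(D), functions being represented by their Taylor coefficients at 0:
   f(z) = sum_k a_k z^k converges on the open unit disk *)
Definition holD (a : nat -> R[i]) : Prop :=
  forall z : R[i], cmod z < 1 -> pconv a z.

Definition H2norm2 (b : nat -> R[i]) : \bar R :=
  (\sum_(0 <= k <oo) (sqmod (b k))%:E)%E.

Definition inH2 (b : nat -> R[i]) : Prop := (H2norm2 b < +oo)%E.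

Definition Ddecomp (zeta : R[i]) (a : nat -> R[i]) (c : R[i]) (b : nat -> R[i]) :
  Prop :=
  inH2 b /\ forall z : R[i], cmod z < 1 -> pval a z = c + (z - zeta) * pval b z.

(* local Dirichlet integral D_zeta(f): ||g||_{H^2}^2 if f = c + (z-zeta) g
   with g in H^2 (g is then unique), +oo if no such decomposition exists
   (the infimum of the empty set is +oo). *)
Definition Dzeta (zeta : R[i]) (a : nat -> R[i]) : \bar R :=
  ereal_inf [set H2norm2 b | b in [set b | exists c, Ddecomp zeta a c b]].

Definition cpt (p : R * R) : R[i] := Complex p.1 p.2.

Definition cdisk : set (R * R) := [set p | p.1 ^+ 2 + p.2 ^+ 2 <= 1].

Definition Dmu (mu : {finite_measure set (R * R)%type -> \bar R})
  (a : nat -> R[i]) : \bar R :=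
  (\int[mu]_(p in cdisk) Dzeta (cpt p) a)%E.

Definition Dmu_norm2 (mu : {finite_measure set (R * R)%type -> \bar R})
  (a : nat -> R[i]) : \bar R :=
  ((sqmod (a 0%N))%:E + Dmu mu a)%E.

Definition pn_coef (w : nat -> nat -> R[i]) (a : nat -> R[i]) (n k : nat) : R[i] :=
  if (k <= n)%N then w n k * a k else 0.

End Dirichlet.

(* Main.v *)
(** If [f = c + (z - zeta) g], comparing Taylor coefficients gives
    [a_(k+1) = b_k - zeta b_(k+1)].  Summation by parts then shows that
    [f - p_n] has a decomposition whose quotient has coefficients
    [(1 - w_(n,j+1)) b_j - \sum_(j < k <= n) (w_(n,k+1) - w_(n,k)) zeta^(k-j) b_k].
    By Cauchy-Schwarz and [|w_(n,k+1) - w_(n,k)| <= L / n], its squared H^2 norm is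
    at most [2 (1 + M)^2 + 4 L^2] times that of [g], and it tends to 0 for each
    [zeta].  Dominated convergence concludes.  Measurability of
    [zeta |-> D_zeta(f)] follows from the formula
    [b_j = \sum_k a_(j+k+1) zeta^k], valid on the closed disk whenever
    [D_zeta(f)] is finite since [b_n] tends to 0. *)

Require Import Defs.
From HB Require Import structures.
From mathcomp Require Import all_boot all_order all_algebra.
From mathcomp Require Import all_classical all_reals all_analysis.
From mathcomp Require Import complex measurable_realfun ring lra.
Import Order.TTheory GRing.Theory Num.Theory numFieldNormedType.Exports.
Local Open Scope ring_scope.
Local Open Scope classical_set_scope.

Set Implicit Arguments.
Unset Strict Implicit.
Unset Printing Implicit Defensive.

(** * Real part, imaginary part and modulus of complex numbers *)

Lemma cReD (R : realType) (x y : R[i]) :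
  complex.Re (x + y) = complex.Re x + complex.Re y.
Proof. by case: x; case: y. Qed.

Lemma cImD (R : realType) (x y : R[i]) :
  complex.Im (x + y) = complex.Im x + complex.Im y.
Proof. by case: x; case: y. Qed.

Lemma cReN (R : realType) (x : R[i]) : complex.Re (- x) = - complex.Re x.
Proof. by case: x. Qed.

Lemma cImN (R : realType) (x : R[i]) : complex.Im (- x) = - complex.Im x.
Proof. by case: x. Qed.

Lemma cReM (R : realType) (x y : R[i]) : complex.Re (x * y) =
  complex.Re x * complex.Re y - complex.Im x * complex.Im y.
Proof. by case: x; case: y. Qed.

Lemma cImM (R : realType) (x y : R[i]) : complex.Im (x * y) =
  complex.Re x * complex.Im y + complex.Im x * complex.Re y.
Proof. by case: x; case: y. Qed.

Lemma cRe_sum (R : realType) (I : Type) (r : seq I) (P : pred I) (u : I -> R[i]) :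
  complex.Re (\sum_(i <- r | P i) u i) = \sum_(i <- r | P i) complex.Re (u i).
Proof. by apply: big_morph => // x y; rewrite cReD. Qed.

Lemma cIm_sum (R : realType) (I : Type) (r : seq I) (P : pred I) (u : I -> R[i]) :
  complex.Im (\sum_(i <- r | P i) u i) = \sum_(i <- r | P i) complex.Im (u i).
Proof. by apply: big_morph => // x y; rewrite cImD. Qed.

Lemma sqmod_ge0 (R : realType) (z : R[i]) : 0 <= sqmod z.
Proof. by rewrite addr_ge0 ?sqr_ge0. Qed.

Lemma cmod_ge0 (R : realType) (z : R[i]) : 0 <= cmod z.
Proof. exact: sqrtr_ge0. Qed.

Lemma sqmodE (R : realType) (z : R[i]) : sqmod z = cmod z ^+ 2.
Proof. by rewrite sqr_sqrtr// sqmod_ge0. Qed.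

Lemma cmodE (R : realType) (z : R[i]) : cmod z = Normc.normc z.
Proof. by case: z. Qed.

Lemma cmod0 (R : realType) : cmod (0 : R[i]) = 0.
Proof. by rewrite cmodE Normc.normc0. Qed.

Lemma cmod1 (R : realType) : cmod (1 : R[i]) = 1.
Proof. by rewrite cmodE Normc.normc1. Qed.

Lemma cmodM (R : realType) (x y : R[i]) : cmod (x * y) = cmod x * cmod y.
Proof. by rewrite !cmodE Normc.normcM. Qed.

Lemma cmodN (R : realType) (x : R[i]) : cmod (- x) = cmod x.
Proof. by rewrite !cmodE normcN. Qed.

Lemma cmodD (R : realType) (x y : R[i]) : cmod (x + y) <= cmod x + cmod y.
Proof. by rewrite !cmodE le_normcD. Qed.

Lemma cmodX (R : realType) (x : R[i]) n : cmod (x ^+ n) = cmod x ^+ n.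
Proof. by elim: n => [|n IH]; rewrite ?expr0 ?cmod1// !exprS cmodM IH. Qed.

Lemma cmodX_le1 (R : realType) (x : R[i]) n : cmod x <= 1 -> cmod (x ^+ n) <= 1.
Proof. by move=> x1; rewrite cmodX exprn_ile1// cmod_ge0. Qed.

Lemma cmod_sum (R : realType) (I : eqType) (r : seq I) (P : pred I)
    (u : I -> R[i]) :
  cmod (\sum_(i <- r | P i) u i) <= \sum_(i <- r | P i) cmod (u i).
Proof.
elim/big_ind2 : _ => //; first by rewrite cmod0.
by move=> x y x' y' h h'; rewrite (le_trans (cmodD _ _))// lerD.
Qed.

Lemma sqmodD_le (R : realType) (x y : R[i]) :
  sqmod (x + y) <= 2 * sqmod x + 2 * sqmod y.
Proof.
have := sqr_ge0 (complex.Re x - complex.Re y).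
have := sqr_ge0 (complex.Im x - complex.Im y).
by rewrite /sqmod cReD cImD; nra.
Qed.

Lemma Re_le_cmod (R : realType) (z : R[i]) : `|complex.Re z| <= cmod z.
Proof.
by rewrite -sqrtr_sqr ler_wsqrtr// lerDl sqr_ge0.
Qed.

Lemma Im_le_cmod (R : realType) (z : R[i]) : `|complex.Im z| <= cmod z.
Proof.
by rewrite -sqrtr_sqr ler_wsqrtr// lerDr sqr_ge0.
Qed.

Lemma complex_eq (R : realType) (x y : R[i]) :
  complex.Re x = complex.Re y -> complex.Im x = complex.Im y -> x = y.
Proof. by case: x y => [? ?] [? ?] /= -> ->. Qed.

(** * Componentwise convergence of complex sequences *)

Definition ccvg (R : realType) (u : nat -> R[i]) (l : R[i]) : Prop :=
  (fun n => complex.Re (u n)) @ \oo --> complex.Re l /\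
  (fun n => complex.Im (u n)) @ \oo --> complex.Im l.

Lemma ccvg_cst (R : realType) (l : R[i]) : ccvg (fun=> l) l.
Proof. by split; exact: cvg_cst. Qed.

Lemma ccvgD (R : realType) (u v : nat -> R[i]) (l m : R[i]) :
  ccvg u l -> ccvg v m -> ccvg (fun n => u n + v n) (l + m).
Proof.
move=> [ul ul'] [vm vm']; split.
  by under eq_fun do rewrite cReD; rewrite cReD; exact: cvgD.
by under eq_fun do rewrite cImD; rewrite cImD; exact: cvgD.
Qed.

Lemma ccvgN (R : realType) (u : nat -> R[i]) (l : R[i]) :
  ccvg u l -> ccvg (fun n => - u n) (- l).
Proof.
move=> [ul ul']; split.
  by under eq_fun do rewrite cReN; rewrite cReN; exact: cvgN.
by under eq_fun do rewrite cImN; rewrite cImN; exact: cvgN.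
Qed.

Lemma ccvgM (R : realType) (u v : nat -> R[i]) (l m : R[i]) :
  ccvg u l -> ccvg v m -> ccvg (fun n => u n * v n) (l * m).
Proof.
move=> [ul ul'] [vm vm']; split.
  by under eq_fun do rewrite cReM; rewrite cReM; apply: cvgB; exact: cvgM.
by under eq_fun do rewrite cImM; rewrite cImM; apply: cvgD; exact: cvgM.
Qed.

Lemma ccvg_sqmod (R : realType) (u : nat -> R[i]) (l : R[i]) :
  ccvg u l -> sqmod (u n) @[n --> \oo] --> sqmod l.
Proof.
move=> [ul ul']; rewrite /sqmod; under eq_fun do rewrite !expr2.
by rewrite !expr2; apply: cvgD; exact: cvgM.
Qed.

Lemma ccvg_unique (R : realType) (u : nat -> R[i]) (l m : R[i]) :
  ccvg u l -> ccvg u m -> l = m.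
Proof.
move=> [ul ul'] [um um']; apply: complex_eq.
- by rewrite -(cvg_lim (@Rhausdorff R) ul) -(cvg_lim (@Rhausdorff R) um).
- by rewrite -(cvg_lim (@Rhausdorff R) ul') -(cvg_lim (@Rhausdorff R) um').
Qed.

Lemma ccvgS (R : realType) (u : nat -> R[i]) (l : R[i]) :
  ccvg (fun n => u n.+1) l <-> ccvg u l.
Proof.
rewrite /ccvg -(cvg_shiftS (fun n => complex.Re (u n))).
by rewrite -(cvg_shiftS (fun n => complex.Im (u n))).
Qed.

Lemma ccvg0 (R : realType) (u : nat -> R[i]) :
  (cmod (u n) @[n --> \oo] --> (0 : R)) -> ccvg u 0.
Proof.
move=> u0; split; apply/cvgr0Pnorm_le => e e0; near=> n.
- apply: (le_trans (Re_le_cmod _)); rewrite -[cmod _]ger0_norm ?cmod_ge0//.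
  by near: n; move/cvgr0Pnorm_le : u0; exact.
- apply: (le_trans (Im_le_cmod _)); rewrite -[cmod _]ger0_norm ?cmod_ge0//.
  by near: n; move/cvgr0Pnorm_le : u0; exact.
Unshelve. all: by end_near. Qed.

Lemma pval_cvg (R : realType) (a : nat -> R[i]) (z : R[i]) :
  pconv a z -> ccvg (psum a z) (pval a z).
Proof. by []. Qed.

Lemma ccvg_pconv (R : realType) (a : nat -> R[i]) (z l : R[i]) :
  ccvg (psum a z) l -> pconv a z.
Proof. by move=> [ul ul']; split; apply/cvg_ex; eexists; eassumption. Qed.

(** * Partial sums, tails and terms of the [H^2] norm *)

Lemma H2norm2_ge0 (R : realType) (b : nat -> R[i]) : (0 <= H2norm2 b)%E.
Proof. by apply: nneseries_ge0 => n _ _; rewrite lee_fin sqmod_ge0. Qed.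

Lemma H2norm2_ge_psum (R : realType) (b : nat -> R[i]) (m n : nat) :
  ((\sum_(m <= k < n) sqmod (b k))%:E <= H2norm2 b)%E.
Proof.
apply: (@le_trans _ _ (\sum_(0 <= k < n) (sqmod (b k))%:E)%E); last first.
  by apply: nneseries_lim_ge => k _ _; rewrite lee_fin sqmod_ge0.
rewrite sumEFin lee_fin; have [mn|nm] := leqP m n.
  rewrite [leRHS](@big_cat_nat _ _ _ m)//= lerDr.
  by apply: sumr_ge0 => k _; exact: sqmod_ge0.
rewrite big_geq 1?ltnW//.
by apply: sumr_ge0 => k _; exact: sqmod_ge0.
Qed.

Lemma H2norm2_le (R : realType) (b : nat -> R[i]) (S : R) :
  (forall n, \sum_(0 <= k < n) sqmod (b k) <= S) -> (H2norm2 b <= S%:E)%E.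
Proof.
move=> bS; apply: lime_le.
  by apply: is_cvg_nneseries => k _ _; rewrite lee_fin sqmod_ge0.
by apply: nearW => n; rewrite sumEFin lee_fin.
Qed.

Lemma inH2_tail (R : realType) (b : nat -> R[i]) (e : R) : inH2 b -> 0 < e ->
  exists K, forall n, \sum_(K <= k < n) sqmod (b k) <= e.
Proof.
move=> bH e0.
have sq0 k : xpredT k -> (0 <= (sqmod (b k))%:E)%E by rewrite lee_fin sqmod_ge0.
have := nneseries_tail_cvg bH sq0 => /fine_cvgP[[M _ finM]].
move=> /(cvgr0_norm_le)/(_ e e0) [K _ HK].
(* Beyond this index the tail of the series is both finite and at most [e]. *)
exists (maxn K M) => n.
have := HK (maxn K M) (leq_maxl _ _); have := finM (maxn K M) (leq_maxr _ _).
move: (maxn K M) => N /= fin; rewrite ger0_norm; last first.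
  by apply: fine_ge0; apply: nneseries_ge0 => k _ _; rewrite lee_fin sqmod_ge0.
apply: le_trans; rewrite -lee_fin fineK// -sumEFin.
by apply: nneseries_lim_ge => k _ _; rewrite lee_fin sqmod_ge0.
Qed.

(** A single squared term is at most the tail that contains it. *)
Lemma inH2_cvg0 (R : realType) (b : nat -> R[i]) : inH2 b ->
  cmod (b n) @[n --> \oo] --> (0 : R).
Proof.
move=> bH; apply/cvgr0Pnorm_le => e e0.
have [K HK] := inH2_tail bH (exprn_gt0 2 e0).
exists K => // n /= Kn; rewrite ger0_norm ?cmod_ge0//.
rewrite -(@ler_sqr _ (cmod _)) ?nnegrE ?cmod_ge0 ?(ltW e0)// -sqmodE.
apply: le_trans (HK n.+1); rewrite big_nat_recr//= lerDr.
by apply: sumr_ge0 => k _; exact: sqmod_ge0.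
Qed.

Lemma inH2_bounded (R : realType) (b : nat -> R[i]) : inH2 b ->
  exists2 B, 0 <= B & forall n, cmod (b n) <= B.
Proof.
move=> bH; have := H2norm2_ge_psum b; move: bH; rewrite /inH2.
have := H2norm2_ge0 b; case: (H2norm2 b) => [s| |]// s0 _ bs.
exists (Num.sqrt s) => [|n]; first exact: sqrtr_ge0.
by rewrite ler_wsqrtr//; have := bs n n.+1; rewrite lee_fin big_nat1.
Qed.

(** * Uniqueness of power series coefficients *)

Lemma sum_half_le (R : realType) n : \sum_(k < n) (2^-1 : R) ^+ k <= 2.
Proof.
suff -> : \sum_(k < n) (2^-1 : R) ^+ k = 2 - 2 * 2^-1 ^+ n.
  by rewrite gerBl mulr_ge0// exprn_ge0// invr_ge0.
elim: n => [|n IH]; first by rewrite big_ord0 expr0; lra.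
by rewrite big_ord_recr/= IH exprS; lra.
Qed.

(** Convergence at [1/2] bounds [|u k| / 2^k] by some [B]. For [x <= 1/4] the terms of index at
    least 1 then sum to at most [4 B x], so [|u 0| <= 4 B x], and [x] can be taken small. The point
    [x = 0] is excluded so that the induction that follows may divide by [x]. *)
Lemma power_series_eq0_head (R : realType) (u : nat -> R) :
  (forall x, 0 < x < 1 ->
    (\sum_(k < n) u k * x ^+ k) @[n --> \oo] --> (0 : R)) -> u 0%N = 0.
Proof.
move=> u0.
have [B B0 uB] : exists2 B, 0 <= B & forall k, `|u k| * 2^-1 ^+ k <= B.
  have h : 0 < (2^-1 : R) < 1 by apply/andP; split; lra.
  have /cvgP /cvg_seq_bounded [B [Bre HB]] := u0 _ h.
  have {}HB n : `|\sum_(k < n) u k * 2^-1 ^+ k| <= `|B| + 1.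
    by apply: HB => //; rewrite (le_lt_trans (ler_norm B))// ltrDl.
  (* Each term is the difference of two consecutive partial sums, hence the factor 2. *)
  exists (2 * (`|B| + 1)) => [|k]; first by rewrite mulr_ge0// addr_ge0.
  rewrite -[X in _ * X]ger0_norm ?exprn_ge0 ?invr_ge0// -normrM.
  have -> : u k * 2^-1 ^+ k =
      \sum_(j < k.+1) u j * 2^-1 ^+ j - \sum_(j < k) u j * 2^-1 ^+ j.
    by rewrite big_ord_recr/= addrAC subrr add0r.
  by rewrite (le_trans (ler_normB _ _))// mulr_natl mulr2n lerD.
have bnd x : 0 < x <= 4^-1 -> `|u 0%N| <= 4 * B * x.
  move=> /andP[x0 x4].
  have x01 : 0 < x < 1 by apply/andP; split=> //; lra.
  have /cvgr0Pnorm_le ux := u0 _ x01.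
  apply/ler_addgt0Pr => e e0; have [n _ Hn] := ux e e0.
  have := Hn n.+1 (leqnSn n) => /=; rewrite big_ord_recl expr0 mulr1 => ne.
  set s := \sum_(k < n) _ in ne.
  have sB : `|s| <= 4 * B * x.
    apply: (le_trans (ler_norm_sum _ _ _)).
    apply: (@le_trans _ _ (\sum_(k < n) (2 * B * x) * 2^-1 ^+ k)); last first.
      rewrite -mulr_sumr (_ : 4 * B * x = (2 * B * x) * 2); last by ring.
      by rewrite ler_wpM2l ?sum_half_le// !mulr_ge0// ltW.
    apply: ler_sum => k _; rewrite lift0 normrM.
    rewrite [`|x ^+ _|]ger0_norm ?exprn_ge0 ?(ltW x0)//.
    (* The factor [2^-(k+1)] is absorbed by the bound at [1/2]; the rest is [2x] times a power of
       [2x <= 1/2], which is summed geometrically. *)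
    have -> : x ^+ k.+1 = 2^-1 ^+ k.+1 * (2 * x) ^+ k.+1.
      by rewrite -exprMn mulrA mulVf ?mul1r.
    rewrite [(2 * x) ^+ _]exprS !mulrA -[_ * 2 * x]mulrA.
    rewrite (_ : 2 * B * x = B * (2 * x)); last by ring.
    rewrite ler_pM//.
    - by rewrite !mulr_ge0// ?exprn_ge0 ?invr_ge0 ?(ltW x0).
    - by rewrite exprn_ge0// mulr_ge0// ltW.
    - by rewrite ler_wpM2r ?uB// mulr_ge0// ltW.
    - by apply: lerXn2r; rewrite ?nnegrE; lra.
  rewrite -[u 0%N](addrK s) (le_trans (ler_normB _ _))// addrC.
  exact: lerD.
apply/eqP/negPn/negP => un0.
have un : 0 < `|u 0%N| by rewrite normr_gt0.
have d0 : 0 < 8 * B + 4 * `|u 0%N| by rewrite ltr_wpDl ?mulr_ge0 ?mulr_gt0.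
(* This [x] is at most [1/4] and makes [4 B x] smaller than [|u 0|], a contradiction. *)
have := bnd (`|u 0%N| / (8 * B + 4 * `|u 0%N|)).
rewrite divr_gt0//= ler_pdivrMr// mulrA ler_pdivlMr//.
have -> : `|u 0%N| <= 4^-1 * (8 * B + 4 * `|u 0%N|) by lra.
by move=> /(_ isT); nra.
Qed.

(** Once the head vanishes, dividing by [x] gives the same hypothesis for the shifted sequence. *)
Lemma power_series_eq0 (R : realType) (u : nat -> R) :
  (forall x, 0 < x < 1 ->
    (\sum_(k < n) u k * x ^+ k) @[n --> \oo] --> (0 : R)) -> forall k, u k = 0.
Proof.
move=> u0 k; elim: k u u0 => [|k IH] u u0; first exact: power_series_eq0_head.
apply: (IH (fun k => u k.+1)) => x x01.
have xn0 : x != 0 by case/andP: x01 => x0 _; rewrite gt_eqF.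
have -> : (fun n => \sum_(k < n) u k.+1 * x ^+ k) =
    (fun n => x^-1 * \sum_(k < n.+1) u k * x ^+ k).
  apply/funext => n; rewrite big_ord_recl (power_series_eq0_head u0) mul0r add0r.
  rewrite mulr_sumr; apply: eq_bigr => i _.
  by rewrite lift0 exprS mulrCA mulKf.
rewrite -[X in _ --> X](mulr0 x^-1); apply: cvgMr.
have := u0 _ x01.
by rewrite -(cvg_shiftS (fun n => \sum_(k < n) u k * x ^+ k)).
Qed.

(** On the real segment [0 < x < 1] the real and imaginary parts are two separate real power
    series. *)
Lemma complex_power_series_eq0 (R : realType) (e : nat -> R[i]) :
  (forall z, cmod z < 1 -> ccvg (psum e z) 0) -> forall k, e k = 0.
Proof.
move=> e0.
have rX (x : R) k : (Complex x 0) ^+ k = Complex (x ^+ k) 0.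
  elim: k => [|k IH]//; rewrite !exprS IH.
  by apply: complex_eq; rewrite ?cReM ?cImM /= ?mulr0 ?mul0r ?subr0 ?addr0.
have x1 (x : R) : 0 < x < 1 -> cmod (Complex x 0) < 1.
  move=> /andP[x0 x1].
  by rewrite /cmod /sqmod/= expr0n/= addr0 sqrtr_sqr ger0_norm// ltW.
move=> k; apply: complex_eq.
- apply: (power_series_eq0 (u := fun k => complex.Re (e k))) => x x01.
  have [h _] := e0 _ (x1 _ x01); move: h.
  rewrite (_ : (fun n => complex.Re _) =
    fun n => \sum_(k < n) complex.Re (e k) * x ^+ k)//.
  apply/funext => n; rewrite /psum cRe_sum; apply: eq_bigr => i _.
  by rewrite rX cReM /= mulr0 subr0.
- apply: (power_series_eq0 (u := fun k => complex.Im (e k))) => x x01.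
  have [_ h] := e0 _ (x1 _ x01); move: h.
  rewrite (_ : (fun n => complex.Im _) =
    fun n => \sum_(k < n) complex.Im (e k) * x ^+ k)//.
  apply/funext => n; rewrite /psum cIm_sum; apply: eq_bigr => i _.
  by rewrite rX cImM /= mulr0 add0r.
Qed.

(** * Decompositions [f = c + (z - zeta) g] in terms of coefficients *)

(** The coefficients are bounded, so the series is dominated by a geometric one of ratio
    [|z| < 1]. *)
Lemma inH2_pconv (R : realType) (b : nat -> R[i]) (z : R[i]) :
  inH2 b -> cmod z < 1 -> pconv b z.
Proof.
move=> /inH2_bounded [B B0 bB] z1.
have bz k : cmod (b k * z ^+ k) <= geometric B (cmod z) k.
  by rewrite /= cmodM cmodX ler_wpM2r ?exprn_ge0 ?cmod_ge0.
have cg : cvgn (series (geometric B (cmod z))).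
  by apply: is_cvg_geometric_series; rewrite ger0_norm ?cmod_ge0.
have cvg_of (u : nat -> R) :
    (forall k, `|u k| <= cmod (b k * z ^+ k)) -> cvgn (fun n => \sum_(k < n) u k).
  move=> ub; have : cvgn (series u).
    apply: normed_cvg; apply: (series_le_cvg _ _ _ cg) => k //=.
    - by rewrite mulr_ge0// exprn_ge0// cmod_ge0.
    - exact: (le_trans (ub k) (bz k)).
  rewrite (_ : series u = fun n => \sum_(k < n) u k)//.
  by apply/funext => n; rewrite /series/= big_mkord.
split.
- rewrite (_ : (fun n => _) = fun n => \sum_(k < n) complex.Re (b k * z ^+ k)).
    by apply: (cvg_of (fun k => complex.Re (b k * z ^+ k))) => k; exact: Re_le_cmod.
  by apply/funext => n; rewrite /psum cRe_sum.
- rewrite (_ : (fun n => _) = fun n => \sum_(k < n) complex.Im (b k * z ^+ k)).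
    by apply: (cvg_of (fun k => complex.Im (b k * z ^+ k))) => k; exact: Im_le_cmod.
  by apply/funext => n; rewrite /psum cIm_sum.
Qed.

(** The comparison of coefficients in degrees at least 1; degree 0 only determines the constant
    [c]. *)
Definition coef_decomp (R : realType) (zeta : R[i]) (a b : nat -> R[i]) : Prop :=
  forall k, a k.+1 = b k - zeta * b k.+1.

Lemma DdecompP (R : realType) (zeta : R[i]) (a b : nat -> R[i]) :
  holD a ->
  (exists c, Ddecomp zeta a c b) <-> inH2 b /\ coef_decomp zeta a b.
Proof.
move=> ha.
(* The Taylor coefficients of [f - c - (z - zeta) g]. *)
pose e c k := if k is j.+1 then a j.+1 - (b j - zeta * b j.+1)
                           else a 0%N - c + zeta * b 0%N.
(* Multiplication by [z] raises degrees by one, so the sums of [b] occur with two lengths, [n] and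
   [n.+1]; they have the same limit. *)
have pe c z n : psum (e c) z n.+1 =
    psum a z n.+1 - c - z * psum b z n + zeta * psum b z n.+1.
  elim: n => [|n IH].
    by rewrite /psum !big_ord_recl !big_ord0 !expr0 /=; ring.
  have rec u : psum u z n.+2 = psum u z n.+1 + u n.+1 * z ^+ n.+1.
    by rewrite /psum big_ord_recr.
  rewrite rec IH !rec (_ : psum b z n.+1 = psum b z n + b n * z ^+ n); last first.
    by rewrite /psum big_ord_recr.
  by rewrite /= exprS; ring.
have ce c z : inH2 b -> cmod z < 1 ->
    ccvg (psum (e c) z) (pval a z - (c + (z - zeta) * pval b z)).
  move=> bH z1; apply/ccvgS.
  have cb := pval_cvg (inH2_pconv bH z1).
  have ca := pval_cvg (ha _ z1).
  rewrite (_ : (fun n => _) = fun n => psum a z n.+1 + (- c)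
    + (- z) * psum b z n + zeta * psum b z n.+1); last first.
    by apply/funext => n; rewrite pe; ring.
  rewrite (_ : pval a z - _ =
    pval a z + (- c) + (- z) * pval b z + zeta * pval b z); last by ring.
  apply: ccvgD; last by apply: ccvgM; [exact: ccvg_cst|apply/ccvgS].
  apply: ccvgD; last by apply: ccvgM; [exact: ccvg_cst|].
  by apply: ccvgD; [apply/ccvgS|exact: ccvg_cst].
split=> [[c [bH abc]]|[bH rec]].
  split=> // k; have /(_ k.+1) : forall k, e c k = 0.
    apply: complex_power_series_eq0 => z z1; have := ce c z bH z1.
    by rewrite abc// subrr.
  by move=> /eqP; rewrite subr_eq0 => /eqP.
(* The constant that makes the coefficient of degree 0 vanish. *)
exists (a 0%N + zeta * b 0%N); split=> // z z1.
apply/eqP; rewrite -subr_eq0; apply/eqP; apply: (ccvg_unique (ce _ z bH z1)).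
rewrite (_ : psum _ _ = fun=> 0); first exact: ccvg_cst.
apply/funext => n; rewrite /psum big1// => -[[|k] kn] _ /=.
  by ring.
by rewrite rec subrr mul0r.
Qed.

(** * Recovering [g] from [f] on the closed disk *)

Definition tail_sum (R : realType) (zeta : R[i]) (a : nat -> R[i]) (j n : nat) :
  R[i] := \sum_(k < n) a (j + k).+1 * zeta ^+ k.

(* The coefficients of [g]: on the closed disk the series
   [\sum_k a_(j+k+1) zeta^k] converges to them whenever [f] has a decomposition;
   the upper limit provides a measurable junk value elsewhere. *)
Definition quotient_coef (R : realType) (a : nat -> R[i]) (zeta : R[i])
    (j : nat) : R[i] :=
  Complex
    (fine (limn_esup (fun n => (complex.Re (tail_sum zeta a j n))%:E)))
    (fine (limn_esup (fun n => (complex.Im (tail_sum zeta a j n))%:E))).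

(** The sum telescopes: its [k]-th term is [zeta^k b_(j+k) - zeta^(k+1) b_(j+k+1)]. *)
Lemma tail_sumE (R : realType) (zeta : R[i]) (a b : nat -> R[i]) (j n : nat) :
  coef_decomp zeta a b -> tail_sum zeta a j n = b j - zeta ^+ n * b (j + n)%N.
Proof.
move=> ab; elim: n => [|n IH].
  by rewrite /tail_sum big_ord0 expr0 mul1r addn0 subrr.
rewrite /tail_sum big_ord_recr/= -/(tail_sum _ _ _ _) IH ab addnS exprS.
by ring.
Qed.

(** The remainder [zeta^n b_(j+n)] tends to 0 even when [|zeta| = 1], because [b] tends to 0. *)
Lemma tail_sum_cvg (R : realType) (zeta : R[i]) (a b : nat -> R[i]) (j : nat) :
  cmod zeta <= 1 -> inH2 b -> coef_decomp zeta a b ->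
  ccvg (tail_sum zeta a j) (b j).
Proof.
move=> z1 bH ab.
rewrite (_ : tail_sum _ _ _ = fun n => b j - zeta ^+ n * b (j + n)%N); last first.
  by apply/funext => n; exact: tail_sumE.
rewrite -[X in ccvg _ X]subr0; apply: ccvgD; first exact: ccvg_cst.
apply: ccvgN; apply: ccvg0.
have b0 : cmod (b (j + n)%N) @[n --> \oo] --> (0 : R).
  under eq_fun do rewrite addnC.
  by have := inH2_cvg0 bH; rewrite -(cvg_shiftn j (fun n => cmod (b n))).
apply: (squeeze_cvgr _ (cvg_cst 0) b0); apply: nearW => n.
rewrite cmod_ge0/= cmodM; apply: ler_piMl; first exact: cmod_ge0.
exact: cmodX_le1.
Qed.

(** This gives the uniqueness of [g]: the right-hand side depends on [f] and [zeta] only. The upper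
    limits are limits here. *)
Lemma quotient_coefE (R : realType) (zeta : R[i]) (a b : nat -> R[i]) :
  cmod zeta <= 1 -> inH2 b -> coef_decomp zeta a b -> b = quotient_coef a zeta.
Proof.
move=> z1 bH ab; apply/funext => j; have [cr ci] := tail_sum_cvg j z1 bH ab.
apply: complex_eq => /=.
- suff /cvg_limn_einf_sup[_ ->] : (complex.Re (tail_sum zeta a j n))%:E
    @[n --> \oo] --> (complex.Re (b j))%:E by [].
  by apply: cvg_EFin => //; exact: nearW.
- suff /cvg_limn_einf_sup[_ ->] : (complex.Im (tail_sum zeta a j n))%:E
    @[n --> \oo] --> (complex.Im (b j))%:E by [].
  by apply: cvg_EFin => //; exact: nearW.
Qed.

(** By uniqueness of [g], the infimum ranges over a single value. *)
Lemma Dzeta_decomp (R : realType) (zeta : R[i]) (a b : nat -> R[i]) :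
  cmod zeta <= 1 -> holD a -> inH2 b -> coef_decomp zeta a b ->
  Dzeta zeta a = H2norm2 b.
Proof.
move=> z1 ha bH ab; apply/eqP; rewrite eq_le; apply/andP; split.
  by apply: ereal_inf_lbound; exists b => //; exact/DdecompP.
apply: le_ereal_inf_tmp => _ [b' /(DdecompP _ _ ha)[bH' ab'] <-].
by rewrite (quotient_coefE z1 bH ab) (quotient_coefE z1 bH' ab').
Qed.

Lemma Dzeta_lty (R : realType) (zeta : R[i]) (a : nat -> R[i]) :
  holD a -> (Dzeta zeta a < +oo)%E -> exists2 b, inH2 b & coef_decomp zeta a b.
Proof.
move=> ha; rewrite /Dzeta; set A := [set b | _].
have [->|/set0P [b /(DdecompP _ _ ha)[bH ab]] _] := eqVneq A set0.
  by rewrite image_set0 ereal_inf0 ltxx.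
by exists b.
Qed.

(** Replaces the infimum by an expression whose measurability in [zeta] can be checked. If the
    recurrence holds but the candidate lies outside [H^2], both sides are [+oo]. *)
Lemma DzetaE (R : realType) (zeta : R[i]) (a : nat -> R[i]) :
  cmod zeta <= 1 -> holD a ->
  Dzeta zeta a = if `[< coef_decomp zeta a (quotient_coef a zeta) >]
    then H2norm2 (quotient_coef a zeta) else +oo%E.
Proof.
move=> z1 ha.
have infty : ~ (inH2 (quotient_coef a zeta) /\
    coef_decomp zeta a (quotient_coef a zeta)) -> Dzeta zeta a = +oo%E.
  move=> nq; apply/eqP; rewrite -leye_eq leNgt; apply/negP => /(Dzeta_lty ha)[b bH ab].
  by apply: nq; rewrite -(quotient_coefE z1 bH ab).
case: asboolP => [qd|nqd]; last by apply: infty => -[].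
have [qH|] := pselect (inH2 (quotient_coef a zeta)); first exact: Dzeta_decomp.
move=> nqH; rewrite infty => [|[]//]; apply/esym/eqP.
by rewrite -leye_eq leNgt; apply/negP.
Qed.

(** * Measurability of [zeta |-> D_zeta(f)] *)

Definition cmeasurable (R : realType) (f : R * R -> R[i]) : Prop :=
  measurable_fun setT (fun p => complex.Re (f p)) /\
  measurable_fun setT (fun p => complex.Im (f p)).

Lemma cmeasurable_cst (R : realType) (c : R[i]) : cmeasurable (fun=> c).
Proof. by split; exact: measurable_cst. Qed.

Lemma cmeasurable_cpt (R : realType) : cmeasurable (@cpt R).
Proof. by split; [exact: measurable_fst|exact: measurable_snd]. Qed.

Lemma cmeasurableD (R : realType) (f g : R * R -> R[i]) :
  cmeasurable f -> cmeasurable g -> cmeasurable (fun p => f p + g p).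
Proof.
move=> [rf jf] [rg jg]; split.
  by under eq_fun do rewrite cReD; exact: measurable_funD.
by under eq_fun do rewrite cImD; exact: measurable_funD.
Qed.

Lemma cmeasurableM (R : realType) (f g : R * R -> R[i]) :
  cmeasurable f -> cmeasurable g -> cmeasurable (fun p => f p * g p).
Proof.
move=> [rf jf] [rg jg]; split.
  by under eq_fun do rewrite cReM; apply: measurable_funB; exact: measurable_funM.
by under eq_fun do rewrite cImM; apply: measurable_funD; exact: measurable_funM.
Qed.

Lemma cmeasurableX (R : realType) (f : R * R -> R[i]) n :
  cmeasurable f -> cmeasurable (fun p => f p ^+ n).
Proof.
move=> mf; elim: n => [|n IH].
  by under eq_fun do rewrite expr0; exact: cmeasurable_cst.
by under eq_fun do rewrite exprS; exact: cmeasurableM.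
Qed.

Lemma cmeasurable_sum (R : realType) (f : nat -> R * R -> R[i]) n :
  (forall k, cmeasurable (f k)) -> cmeasurable (fun p => \sum_(k < n) f k p).
Proof.
move=> mf; elim: n => [|n IH].
  by under eq_fun do rewrite big_ord0; exact: cmeasurable_cst.
by under eq_fun do rewrite big_ord_recr/=; exact: cmeasurableD.
Qed.

(** The partial sums are polynomials in [zeta], and upper limits preserve measurability. *)
Lemma cmeasurable_quotient_coef (R : realType) (a : nat -> R[i]) j :
  cmeasurable (fun p => quotient_coef a (cpt p) j).
Proof.
have mS n : cmeasurable (fun p => tail_sum (cpt p) a j n).
  apply: (cmeasurable_sum (f := fun k p => a (j + k).+1 * cpt p ^+ k)) => k.
  apply: cmeasurableM; first exact: cmeasurable_cst.
  by apply: cmeasurableX; exact: cmeasurable_cpt.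
split; apply: (measurableT_comp (fine_measurable measurableT));
  apply: measurable_fun_limn_esup => n; apply/measurable_EFinP; by case: (mS n).
Qed.

Lemma measurable_cdisk (R : realType) : measurable (@cdisk R).
Proof.
have m1 : measurable_fun setT (fun p : R * R => p.1 ^+ 2 + p.2 ^+ 2 <= 1).
  apply: measurable_fun_ler; last exact: measurable_cst.
  by apply: measurable_funD; apply: measurable_funX;
    [exact: measurable_fst|exact: measurable_snd].
have := m1 measurableT [set true] I.
by rewrite setTI; congr measurable.
Qed.

Lemma cdiskP (R : realType) (p : R * R) : cdisk p -> cmod (cpt p) <= 1.
Proof. by move=> p1; rewrite /cmod -[leRHS]sqrtr1 ler_wsqrtr. Qed.

Lemma measurable_Dzeta (R : realType) (a : nat -> R[i]) : holD a ->
  measurable_fun (@cdisk R) (fun p => Dzeta (cpt p) a).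
Proof.
move=> ha; pose q p := quotient_coef a (cpt p).
have mq k : cmeasurable (fun p => q p k) by exact: cmeasurable_quotient_coef.
apply: (eq_measurable_fun (fun p => if `[< coef_decomp (cpt p) a (q p) >]
    then H2norm2 (q p) else +oo%E)).
  by move=> p; rewrite inE => /cdiskP p1; rewrite -DzetaE.
apply: (measurable_funS measurableT) => //.
apply: measurable_fun_ifT; last exact: measurable_cst.
  (* The recurrence is a countable conjunction of equalities between measurable functions, so it
     holds on a measurable set. *)
  pose g k p := (complex.Re (a k.+1) == complex.Re (q p k - cpt p * q p k.+1)) &&
    (complex.Im (a k.+1) == complex.Im (q p k - cpt p * q p k.+1)).
  have mg k : measurable_fun setT (g k).
    have [rr ri] : cmeasurable (fun p => q p k + (-1) * (cpt p * q p k.+1)).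
      apply: cmeasurableD => //; apply: cmeasurableM; first exact: cmeasurable_cst.
      by apply: cmeasurableM => //; exact: cmeasurable_cpt.
    apply: measurable_and; apply: measurable_fun_eqr; try exact: measurable_cst.
    - by move: rr; under eq_fun do rewrite mulN1r.
    - by move: ri; under eq_fun do rewrite mulN1r.
  apply: (measurable_fun_bool true); rewrite setTI.
  rewrite (_ : _ @^-1` _ = \bigcap_k (g k @^-1` [set true])).
    apply: bigcapT_measurable => k; rewrite -[X in measurable X]setTI.
    exact: mg.
  apply/seteqP; split=> p /=.
    by move=> /asboolP ab k _ /=; rewrite /g ab !eqxx.
  move=> gp; apply/asboolP => k; have /andP[/eqP h1 /eqP h2] := gp k I.
  exact: complex_eq.
apply: (ge0_emeasurable_sum (P := xpredT)) => [k p _ _|k _].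
  by rewrite lee_fin sqmod_ge0.
apply/measurable_EFinP; have [rr ri] := mq k.
by apply: measurable_funD; exact: measurable_funX.
Qed.

(** * The quotient of [f - p_n] and its uniform bound *)

Lemma holD_sub_finite (R : realType) (a p : nat -> R[i]) n :
  (forall k, (n < k)%N -> p k = 0) -> holD a -> holD (fun k => a k - p k).
Proof.
move=> p0 ha z z1; apply: (@ccvg_pconv _ _ _ (pval a z - psum p z n.+1)).
rewrite (_ : psum _ z = fun m => psum a z m + - psum p z m); last first.
  by apply/funext => m; rewrite /psum -sumrB; apply: eq_bigr => k _; rewrite mulrBl.
apply: ccvgD; [exact: pval_cvg (ha _ z1)|apply: ccvgN].
have E : \forall m \near \oo, psum p z m = psum p z n.+1.
  exists n.+1 => // m /= nm; rewrite /psum.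
  rewrite -!(big_mkord xpredT (fun k => p k * z ^+ k)) (@big_cat_nat _ _ _ n.+1)//=.
  rewrite -[RHS]addr0; congr (_ + _); rewrite big_nat_cond big1// => k.
  by rewrite andbT => /andP[nk _]; rewrite p0// mul0r.
by split; apply: cvg_near_cst; apply: filterS E => m ->.
Qed.

(** Cauchy-Schwarz, with [n] bounding the number of terms. Expand [(x_k - t)^2 >= 0], sum over [k],
    and take [t] to be the sum divided by [n]. *)
Lemma sqr_sum_le (R : realType) (x : nat -> R) m n :
  (\sum_(m <= k < n) x k) ^+ 2 <= n%:R * \sum_(m <= k < n) x k ^+ 2.
Proof.
have [->|n0] := posnP n; first by rewrite !big_geq// mulr0 expr0n.
set S := \sum_(_ <= _ < _) x _; set T := \sum_(_ <= _ < _) _ ^+ _.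
have H t : 2 * t * S <= T + n%:R * t ^+ 2.
  apply: (@le_trans _ _ (T + \sum_(m <= k < n) t ^+ 2)); last first.
    by rewrite lerD2l sumr_const_nat -[leLHS]mulr_natl ler_wpM2r ?sqr_ge0// ler_nat leq_subr.
  rewrite /T -big_split/= mulr_sumr; apply: ler_sum => k _.
  by have := sqr_ge0 (x k - t); nra.
have n0' : 0 < n%:R :> R by rewrite ltr0n.
have := H (S / n%:R); set t := S / n%:R.
have -> : S = n%:R * t by rewrite /t mulrC divfK// gt_eqF.
by nra.
Qed.

Lemma sum_nat_split_le (R : realType) (x : nat -> R) K N : (forall k, 0 <= x k) ->
  \sum_(0 <= k < N) x k <= \sum_(0 <= k < K) x k + \sum_(K <= k < N) x k.
Proof.
move=> x0; have [KN|NK] := leqP K N; first by rewrite (@big_cat_nat _ _ _ K).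
rewrite [X in _ + X]big_geq 1?ltnW// addr0 [leRHS](@big_cat_nat _ _ _ N)//= 1?ltnW//.
by rewrite lerDl sumr_ge0.
Qed.

(** With [v = w n], this is [b_j] minus the quotient coefficient
    [\sum_(k >= j) v_(k+1) a_(k+1) zeta^(k-j)] of [p_n], after substituting the recurrence for [a]
    and summing by parts. The sum stops at [n] because [v] vanishes beyond. *)
Definition residual (R : realType) (zeta : R[i]) (v b : nat -> R[i]) (n j : nat) :
  R[i] := (1 - v j.+1) * b j
  - \sum_(j.+1 <= k < n.+1) (v k.+1 - v k) * zeta ^+ (k - j) * b k.

(* Summation by parts. *)
Lemma coef_decomp_residual (R : realType) (zeta : R[i]) (v a b : nat -> R[i]) n :
  (forall k, (n < k)%N -> v k = 0) -> coef_decomp zeta a b ->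
  coef_decomp zeta (fun k => a k - v k * a k) (residual zeta v b n).
Proof.
move=> v0 ab j; rewrite ab /residual; have [jn|nj] := ltnP j n; last first.
  have v1 : v j.+1 = 0 by apply: v0; rewrite ltnS.
  have v2 : v j.+2 = 0 by apply: v0; rewrite ltnS leqW.
  by rewrite v1 v2 !big_geq ?ltnS ?(leqW nj)//; ring.
(* Apart from its term [k = j+1], the sum at [j] is [zeta] times the sum at [j+1], and the two
   cancel. *)
rewrite big_ltn//=.
have -> : \sum_(j.+2 <= k < n.+1) (v k.+1 - v k) * zeta ^+ (k - j) * b k =
    zeta * \sum_(j.+2 <= k < n.+1) (v k.+1 - v k) * zeta ^+ (k - j.+1) * b k.
  rewrite mulr_sumr; apply: eq_big_nat => k /andP[jk _].
  by rewrite -[(k - j)%N]subSS subSn ?(ltnW jk)// exprS; ring.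
by rewrite subSnn expr1; ring.
Qed.

(** The inner sums [T j] vanish for [j >= n] and are at most [d Q] in modulus, so their squares add
    up to at most [n (d Q)^2]. The factors 2 come from [|x + y|^2 <= 2 |x|^2 + 2 |y|^2]. *)
Lemma sum_sqmod_residual (R : realType) (zeta : R[i]) (v b : nat -> R[i]) (d : R) n N :
  cmod zeta <= 1 -> 0 <= d -> (forall k, cmod (v k - v k.+1) <= d) ->
  \sum_(0 <= j < N) sqmod (residual zeta v b n j) <=
  2 * \sum_(0 <= j < N) sqmod (1 - v j.+1) * sqmod (b j) +
  2 * (n%:R * (d * \sum_(0 <= k < n.+1) cmod (b k)) ^+ 2).
Proof.
move=> z1 d0 vd; set Q := \sum_(0 <= k < n.+1) _.
pose T j := \sum_(j.+1 <= k < n.+1) (v k.+1 - v k) * zeta ^+ (k - j) * b k.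
have Q0 : 0 <= Q by apply: sumr_ge0 => k _; exact: cmod_ge0.
have TQ j : sqmod (T j) <= if (j < n)%N then (d * Q) ^+ 2 else 0.
  case: ltnP => jn; last by rewrite /T big_geq// sqmodE cmod0 expr0n.
  rewrite sqmodE lerXn2r ?nnegrE ?cmod_ge0 ?mulr_ge0//.
  apply: (le_trans (cmod_sum _ _ _)).
  apply: (@le_trans _ _ (d * \sum_(j.+1 <= k < n.+1) cmod (b k))).
    rewrite mulr_sumr; apply: ler_sum => k _; rewrite !cmodM -mulrA.
    apply: ler_pM; rewrite ?mulr_ge0 ?cmod_ge0//.
      by rewrite -cmodN opprB.
    by apply: ler_piMl; rewrite ?cmod_ge0 ?cmodX_le1.
  rewrite ler_wpM2l// /Q [leRHS](@big_cat_nat _ _ _ j.+1)//= 1?ltnW//.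
  by rewrite lerDr; apply: sumr_ge0 => k _; exact: cmod_ge0.
have sT : \sum_(0 <= j < N) sqmod (T j) <= n%:R * (d * Q) ^+ 2.
  apply: le_trans (ler_sum _ (fun j _ => TQ j)) _.
  have -> : \sum_(0 <= j < N) (if (j < n)%N then (d * Q) ^+ 2 else 0) =
      (minn N n)%:R * (d * Q) ^+ 2.
    elim: N => [|N IH]; first by rewrite big_geq// min0n mul0r.
    rewrite big_nat_recr//= IH; case: ltnP => Nn.
      by rewrite (minn_idPl Nn) -natr1; ring.
    by rewrite (minn_idPr (leqW Nn)) addr0.
  by rewrite ler_wpM2r ?sqr_ge0// ler_nat geq_minr.
apply: (@le_trans _ _ (2 * \sum_(0 <= j < N) sqmod (1 - v j.+1) * sqmod (b j)
   + 2 * \sum_(0 <= j < N) sqmod (T j))); last by rewrite lerD2l ler_pM2l.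
rewrite !mulr_sumr -big_split/=; apply: ler_sum => j _.
apply: (le_trans (sqmodD_le _ _)).
by rewrite [sqmod (- _)]sqmodE cmodN -sqmodE [sqmod (_ * b j)]sqmodE cmodM exprMn -!sqmodE.
Qed.

Lemma sqmod1B_le (R : realType) (x : R[i]) (M : R) :
  cmod x <= M -> sqmod (1 - x) <= (1 + M) ^+ 2.
Proof.
move=> xM; have M0 : 0 <= M := le_trans (cmod_ge0 _) xM.
rewrite sqmodE lerXn2r ?nnegrE ?cmod_ge0 ?addr_ge0//.
by rewrite (le_trans (cmodD _ _))// cmod1 cmodN lerD2l.
Qed.

Lemma cvge0_le (R : realType) (u : nat -> \bar R) : (forall n, (0 <= u n)%E) ->
  (forall e : R, 0 < e -> \forall n \near \oo, (u n <= e%:E)%E) ->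
  u @ \oo --> 0%E.
Proof.
move=> u0 ue.
have fin n e : (u n <= e%:E)%E -> u n \is a fin_num.
  by move=> h; rewrite ge0_fin_numE// (le_lt_trans h)// ltry.
apply/fine_cvgP; split; first by apply: filterS (ue _ ltr01) => n /fin.
apply/cvgr0Pnorm_le => e e0; apply: filterS (ue _ e0) => n une /=.
by rewrite ger0_norm ?fine_ge0// -lee_fin fineK// (fin _ e).
Qed.

(** With [d = L / n], the factor [n] and the Cauchy-Schwarz factor [n + 1 <= 2 n] are balanced by
    [d^2]. The constant depends on neither [n] nor [zeta], which supplies the dominating
    function. *)
Lemma H2norm2_residual_le (R : realType) (zeta : R[i]) (v b : nat -> R[i])
    (L M : R) n :
  cmod zeta <= 1 -> inH2 b -> (0 < n)%N -> (forall k, cmod (v k) <= M) ->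
  (forall k, cmod (v k - v k.+1) <= L / n%:R) ->
  (H2norm2 (residual zeta v b n) <=
     (2 * (1 + M) ^+ 2 + 4 * L ^+ 2)%:E * H2norm2 b)%E.
Proof.
move=> z1 bH n0 vM vL.
have n0' : 0 < n%:R :> R by rewrite ltr0n.
have d0 : 0 <= L / n%:R := le_trans (cmod_ge0 _) (vL 0%N).
have := H2norm2_ge_psum b; move: bH; rewrite /inH2.
have := H2norm2_ge0 b; case: (H2norm2 b) => [S| |]// S0 _ bS.
rewrite lee_fin in S0.
have {}bS m k : \sum_(m <= i < k) sqmod (b i) <= S by rewrite -lee_fin.
rewrite -EFinM; apply: H2norm2_le => N.
apply: (le_trans (sum_sqmod_residual b n N z1 d0 vL)).
have h1 : \sum_(0 <= j < N) sqmod (1 - v j.+1) * sqmod (b j) <= (1 + M) ^+ 2 * S.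
  apply: (@le_trans _ _ ((1 + M) ^+ 2 * \sum_(0 <= j < N) sqmod (b j))).
    rewrite mulr_sumr; apply: ler_sum => j _.
    by rewrite ler_wpM2r ?sqmod_ge0// sqmod1B_le.
  by rewrite ler_wpM2l ?sqr_ge0.
have h2 : (\sum_(0 <= k < n.+1) cmod (b k)) ^+ 2 <= 2 * n%:R * S.
  apply: (le_trans (sqr_sum_le _ _ _)).
  rewrite ler_pM ?sumr_ge0//.
  - by move=> k _; exact: sqr_ge0.
  - by rewrite -natrM ler_nat mul2n -addnn -addn1 leq_add2l.
  - by under eq_bigr do rewrite -sqmodE; exact: bS.
have h3 : n%:R * (L / n%:R * \sum_(0 <= k < n.+1) cmod (b k)) ^+ 2 <= 2 * L ^+ 2 * S.
  rewrite exprMn.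
  apply: (@le_trans _ _ (n%:R * ((L / n%:R) ^+ 2 * (2 * n%:R * S)))).
    by rewrite ler_wpM2l ?(ltW n0')// ler_wpM2l ?sqr_ge0.
  rewrite le_eqVlt; apply/orP; left; apply/eqP; field.
  by rewrite gt_eqF.
by lra.
Qed.

Lemma inH2_residual (R : realType) (zeta : R[i]) (v b : nat -> R[i]) (L M : R) n :
  cmod zeta <= 1 -> inH2 b -> (0 < n)%N -> (forall k, cmod (v k) <= M) ->
  (forall k, cmod (v k - v k.+1) <= L / n%:R) -> inH2 (residual zeta v b n).
Proof.
move=> z1 bH n0 vM vL; apply: le_lt_trans (H2norm2_residual_le z1 bH n0 vM vL) _.
by rewrite lte_mul_pinfty// lee_fin addr_ge0// mulr_ge0// sqr_ge0.
Qed.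

(** * Convergence to 0 at a fixed [zeta] *)

Lemma cvgr0_sum (R : realType) (u : nat -> nat -> R) K :
  (forall k, u k @ \oo --> (0 : R)) ->
  (\sum_(k < K) u k n) @[n --> \oo] --> (0 : R).
Proof.
move=> u0; elim: K => [|K IH].
  by under eq_fun do rewrite big_ord0; exact: cvg_cst.
under eq_fun do rewrite big_ord_recr/=.
have := @cvgD _ _ _ _ _ _ _ _ _ IH (u0 K); rewrite addr0; exact.
Qed.

(** Split [b] at an index [K]. The tail contributes little uniformly in [n]; the finitely many head
    terms are handled by [w n k] tending to 1 and by a factor [1/n]. *)
Lemma H2norm2_residual_cvg0 (R : realType) (zeta : R[i]) (w : nat -> nat -> R[i])
    (b : nat -> R[i]) (L M : R) :
  cmod zeta <= 1 -> inH2 b ->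
  (forall k, ccvg (fun n => w n k) 1) ->
  (forall n k, cmod (w n k) <= M) ->
  (forall n k, (1 <= n)%N -> cmod (w n k - w n k.+1) <= L / n%:R) ->
  H2norm2 (residual zeta (w n) b n) @[n --> \oo] --> 0%E.
Proof.
move=> z1 bH w1 wM wL; apply: cvge0_le => [n|e e0]; first exact: H2norm2_ge0.
(* The tail bound [t] enters the final estimate with factor [2 (1 + M)^2 + 8 L^2], and
   [C t = e / 2]; the added 1 makes [C] positive. *)
pose C := 2 * (1 + M) ^+ 2 + 8 * L ^+ 2 + 1.
have C0 : 0 < C by rewrite ltr_wpDl// addr_ge0// mulr_ge0// sqr_ge0.
have [K HK] := inH2_tail bH (divr_gt0 e0 (mulr_gt0 (ltr0n _ 2) C0)).
set t := e / (2 * C) in HK.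
have t0 : 0 < t by rewrite divr_gt0// mulr_gt0.
pose Q := \sum_(0 <= k < K) cmod (b k).
(* The contribution of the head, which tends to 0 since [K] is fixed. *)
pose r n := 2 * \sum_(k < K) sqmod (1 - w n k.+1) * sqmod (b k)
  + 4 * L ^+ 2 * Q ^+ 2 * n%:R^-1.
have r0 : r n @[n --> \oo] --> (0 : R).
  rewrite -[X in _ --> X](addr0 0); apply: cvgD.
    rewrite -[X in _ --> X](mulr0 2); apply: cvgMr.
    apply: (cvgr0_sum (u := fun k n => sqmod (1 - w n k.+1) * sqmod (b k))) => k.
    rewrite -[X in _ --> X](mul0r (sqmod (b k))); apply: cvgMl.
    rewrite -[X in _ --> X](_ : sqmod (1 - 1 : R[i]) = 0).
      by apply: ccvg_sqmod; apply: ccvgD; [exact: ccvg_cst|exact: ccvgN].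
    by rewrite subrr sqmodE cmod0 expr0n.
  rewrite -[X in _ --> X](mulr0 (4 * L ^+ 2 * Q ^+ 2)); apply: cvgMr.
  rewrite -(cvg_shiftS (fun n => n%:R^-1 : R)); exact: cvg_harmonic.
have re : \forall n \near \oo, r n <= e / 2.
  move/cvgr0Pnorm_le : r0 => /(_ (e / 2) (divr_gt0 e0 (ltr0n _ 2))).
  by apply: filterS => n; exact: le_trans (ler_norm _).
near=> n.
have n0 : (0 < n)%N by near: n; exact: nbhs_infty_gt.
have rn : r n <= e / 2 by near: n.
have n0' : 0 < n%:R :> R by rewrite ltr0n.
have d0 : 0 <= L / n%:R := le_trans (cmod_ge0 _) (wL n 0%N n0).
apply: H2norm2_le => N.
apply: (le_trans (sum_sqmod_residual b n N z1 d0 (fun k => wL n k n0))).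
have h1 : \sum_(0 <= j < N) sqmod (1 - w n j.+1) * sqmod (b j) <=
    \sum_(k < K) sqmod (1 - w n k.+1) * sqmod (b k) + (1 + M) ^+ 2 * t.
  apply: (le_trans (@sum_nat_split_le _ _ K _ _)) => [k|].
    by rewrite mulr_ge0// sqmod_ge0.
  rewrite big_mkord lerD2l.
  apply: (@le_trans _ _ ((1 + M) ^+ 2 * \sum_(K <= j < N) sqmod (b j))).
    rewrite mulr_sumr; apply: ler_sum => j _.
    by rewrite ler_wpM2r ?sqmod_ge0// sqmod1B_le.
  by rewrite ler_wpM2l ?sqr_ge0.
(* Only the tail part grows with [n], at rate [n t]; Cauchy-Schwarz is applied to it alone. *)
have h2 : (\sum_(0 <= k < n.+1) cmod (b k)) ^+ 2 <= 2 * Q ^+ 2 + 4 * n%:R * t.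
  set P := \sum_(0 <= k < n.+1) _; pose P' := \sum_(K <= k < n.+1) cmod (b k).
  have PQ : P <= Q + P' by apply: sum_nat_split_le => k; exact: cmod_ge0.
  have P0 : 0 <= P by apply: sumr_ge0 => k _; exact: cmod_ge0.
  have P't : P' ^+ 2 <= 2 * n%:R * t.
    apply: (le_trans (sqr_sum_le _ _ _)).
    rewrite ler_pM ?sumr_ge0//.
    - by move=> k _; exact: sqr_ge0.
    - by rewrite -natrM ler_nat mul2n -addnn -addn1 leq_add2l.
    - by under eq_bigr do rewrite -sqmodE; exact: HK.
  have : P ^+ 2 <= (Q + P') ^+ 2 by rewrite lerXn2r ?nnegrE// (le_trans P0).
  by have := sqr_ge0 (Q - P'); lra.
have h3 : n%:R * (L / n%:R * \sum_(0 <= k < n.+1) cmod (b k)) ^+ 2 <=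
    2 * L ^+ 2 * Q ^+ 2 * n%:R^-1 + 4 * L ^+ 2 * t.
  rewrite exprMn.
  apply: (@le_trans _ _ (n%:R * ((L / n%:R) ^+ 2 * (2 * Q ^+ 2 + 4 * n%:R * t)))).
    by rewrite ler_wpM2l ?(ltW n0')// ler_wpM2l ?sqr_ge0.
  rewrite le_eqVlt; apply/orP; left; apply/eqP; field.
  by rewrite gt_eqF.
have h4 : C * t = e / 2 by rewrite /t; field; rewrite gt_eqF.
by move: rn; rewrite /r; move: h1 h3 h4; rewrite /C; lra.
Unshelve. all: by end_near. Qed.

(** * Integration over the closed disk by dominated convergence *)

Unset Implicit Arguments.

Theorem theorem1 (R : realType) (w : nat -> nat -> R[i]) (L M : R)
  (hw0 : forall n k : nat, (n < k)%N -> w n k = 0)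
  (hw1 : forall k : nat,
     (fun n => complex.Re (w n k)) @ \oo --> (1 : R) /\ (fun n => complex.Im (w n k)) @ \oo --> (0 : R))
  (hwM : forall n k : nat, cmod (w n k) <= M)
  (hwL : forall n k : nat, (1 <= n)%N -> cmod (w n k - w n k.+1) <= L / n%:R)
  (a : nat -> R[i]) (ha : holD a)
  (mu : {finite_measure set (R * R)%type -> \bar R})
  (hf : (Dmu mu a < +oo)%E) :
  (fun n => Dmu_norm2 mu (fun k => a k - pn_coef w a n k)) @ \oo --> 0%E.
Proof.
have w1 k : ccvg (fun n => w n k) 1 by exact: hw1.
have pnE n : (fun k => a k - pn_coef w a n k) = (fun k => a k - w n k * a k).
  apply/funext => k; rewrite /pn_coef; case: leqP => // nk.
  by rewrite hw0// mul0r.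
have hol n : holD (fun k => a k - w n k * a k).
  by apply: (@holD_sub_finite _ _ _ n) => // k nk; rewrite hw0// mul0r.
rewrite -[X in _ --> X]adde0; under eq_fun do rewrite pnE.
apply: cvgeD => //.
  (* The value at 0 is settled by [w n 0] tending to 1. *)
  apply: cvg_EFin; first exact: nearW.
  rewrite /comp/= (_ : 0 = sqmod (a 0%N - 1 * a 0%N)); last first.
    by rewrite mul1r subrr sqmodE cmod0 expr0n.
  apply: ccvg_sqmod; apply: ccvgD; first exact: ccvg_cst.
  by apply: ccvgN; apply: ccvgM => //; exact: ccvg_cst.
(* Domination is required at every index, while the bound [L / n] starts at [n = 1]. *)
rewrite -(cvg_shiftS (fun n => Dmu mu (fun k => a k - w n k * a k))).
have mD := @measurable_cdisk R.
have D0 z b : (0 <= @Dzeta R z b)%E.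
  by apply: le_ereal_inf_tmp => _ [c _ <-]; exact: H2norm2_ge0.
(* The added 1 makes [C] positive, so that [C] times [+oo] is [+oo] and domination is trivial where
   [D_zeta(f)] is infinite. *)
pose C := 2 * (1 + M) ^+ 2 + 4 * L ^+ 2 + 1.
have C0 : 0 < C by rewrite ltr_wpDl// addr_ge0// mulr_ge0// sqr_ge0.
have ia : mu.-integrable (@cdisk R) (fun p => Dzeta (cpt p) a).
  apply/integrableP; split; first exact: measurable_Dzeta.
  by under eq_integral do rewrite gee0_abs//.
have [||| _ _] := @dominated_convergence _ _ _ mu _ mD
  (fun n p => Dzeta (cpt p) (fun k => a k - w n.+1 k * a k)) (cst 0%E)
  (fun p => C%:E * Dzeta (cpt p) a)%E
  (fun n => measurable_Dzeta (hol n.+1)) (measurable_cst _).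
(* Integrability makes [D_zeta(f)] finite almost everywhere, so a quotient [b] exists at almost
   every [zeta]. *)
- apply: filterS (integrable_ae mD ia) => p fp dp.
  have /(Dzeta_lty ha)[b bH ab] : (Dzeta (cpt p) a < +oo)%E.
    by rewrite -ge0_fin_numE// fp.
  have p1 := cdiskP dp.
  rewrite (cvg_shiftS (fun n => Dzeta (cpt p) (fun k => a k - w n k * a k))).
  have res := H2norm2_residual_cvg0 p1 bH w1 hwM hwL.
  apply: cvg_trans res; apply: near_eq_cvg.
  near=> n; apply/esym.
  have n0 : (0 < n)%N by near: n; exact: nbhs_infty_gt.
  apply: Dzeta_decomp => //.
    exact: inH2_residual p1 bH n0 (hwM n) (fun k => hwL n k n0).
  by apply: coef_decomp_residual => // k; exact: hw0.
- exact: integrableZl.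
- apply: aeW => p n dp; rewrite gee0_abs//.
  have [->|] := eqVneq (Dzeta (cpt p) a) +oo%E.
    by rewrite gt0_muley ?leey// lte_fin.
  rewrite -ltey => /(Dzeta_lty ha)[b bH ab].
  have p1 := cdiskP dp.
  have wL k := hwL n.+1 k (ltn0Sn n).
  have rH := inH2_residual p1 bH (ltn0Sn n) (hwM n.+1) wL.
  rewrite (Dzeta_decomp p1 ha bH ab) (Dzeta_decomp p1 (hol _) rH); last first.
    by apply: coef_decomp_residual => // k; exact: hw0.
  apply: le_trans (H2norm2_residual_le p1 bH (ltn0Sn n) (hwM n.+1) wL) _.
  apply: lee_wpmul2r; first exact: H2norm2_ge0.
  by rewrite lee_fin lerDl.
- by rewrite integral0.
Unshelve. all: by end_near. Qed.
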